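(* Let $n$ be odd and let $G$ be a connected well-covered unicyclic graph of order $n$. Then $G\preceq M_n$.
   Context: All graphs are finite, simple and undirected. A graph is well-covered if all of its maximal independent sets have the same size. A connected unicyclic graph is a connected graph containing exactly one cycle. The independence polynomial of a graph $G$ is $I(G,x)=\sum_{k\ge 0} i_kx^k$, where $i_k$ is the number of independent sets of size $k$ in $G$. It is known that the root of $I(G,x)$ of smallest modulus is real and lies in $[-1,0)$; it is denoted $\xi(G)$ (equivalently, the largest real root of $I(G,x)$). For graphs $G,H$, write $H\preceq G$ if and only if $I(H,x)\ge I(G,x)$ for all $x\in[\xi(G),0]$. For $m\ge 3$, $U_m$ is the graph on $m$ vertices obtained from a triangle by attaching $m-3$ pendant vertices (leaves) to one fixed vertex of the triangle. For odd $n\ge 3$, $M_n$ is the graph of order $n$ obtained from $U_{(n+3)/2}$ by subdividing each of its pendant edges once; that is, $M_n$ consists of a triangle with a distinguished vertex $c$ together with $\frac{n-3}{2}$ disjoint copies of $K_2$, with exactly one vertex of each copy joined by an edge to $c$. *)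

(* Defs.v *)
From HB Require Import structures.
From mathcomp Require Import all_boot all_order all_algebra.
From mathcomp Require Import complex.
From mathcomp Require Import classical_sets reals.

Set Implicit Arguments.
Unset Strict Implicit.
Unset Printing Implicit Defensive.

Import Order.TTheory GRing.Theory Num.Theory.
Local Open Scope ring_scope.
Local Open Scope complex_scope.

Record sgraph := SGraph {
  vertex :> finType;
  adj : rel vertex;
  adj_sym : symmetric adj;
  adj_irrefl : irreflexive adj
}.

Section Graphs.
Variable G : sgraph.

Definition connected : Prop := forall x y : G, connect (@adj G) x y.

Definition independent (S : {set G}) : bool :=
  [forall x in S, forall y in S, ~~ adj x y].

Definition maximal_independent (S : {set G}) : bool := maxset independent S.

Definition well_covered : Prop :=
  forall S1 S2 : {set G},
    maximal_independent S1 -> maximal_independent S2 -> #|S1| = #|S2|.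

(* A cycle, viewed as a subgraph, is determined by its edge set; this
   identifies the vertex sequences that differ by a rotation or a reversal. *)
Definition cycle_edges (c : seq G) : {set {set G}} :=
  [set [set x; next c x] | x in c].

Definition is_cycle (C : {set {set G}}) : Prop :=
  exists c : seq G,
    [/\ (2 < size c)%N, ucycle (@adj G) c & C = cycle_edges c].

Definition unicyclic : Prop := exists! C : {set {set G}}, is_cycle C.

Definition num_indep (k : nat) : nat :=
  #|[set S : {set G} | independent S & #|S| == k]|.

Definition indep_poly (R : nzRingType) : {poly R} :=
  \poly_(k < #|G|.+1) (num_indep k)%:R.

(* x is a root of I(G), and no complex root has smaller modulus *)
Definition smallest_root (R : realType) (x : R) : Prop :=
  root (indep_poly R) x /\
  forall z : R[i], root (indep_poly R[i]) z -> `|x%:C| <= `|z|.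

(* The roots of I(G) are never nonnegative, so at most one real number is a
   smallest_root; there is one as soon as G has a vertex.  The default value 0
   concerns only the graph without vertices, for which I(G) = 1. *)
Definition xi (R : realType) : R := xget 0 [set x : R | smallest_root x]%classic.

End Graphs.

Definition preceq (R : realType) (H G : sgraph) : Prop :=
  forall x : R, xi G R <= x <= 0 -> (indep_poly G R).[x] <= (indep_poly H R).[x].

Section MGraph.
Variable n : nat.

(* The vertices inl i form the triangle, with c = inl ord0; inr (j, true) and
   inr (j, false) are the two ends of the j-th K_2, the first one adjacent
   to c. *)
Definition M_vertex : finType := ('I_3 + 'I_((n - 3)./2) * bool)%type.

Definition M_adj (u v : M_vertex) : bool :=
  match u, v with
  | inl i, inl j => i != j
  | inl i, inr (_, b) => (i == ord0) && b
  | inr (_, b), inl i => (i == ord0) && b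
  | inr (j, b), inr (j', b') => (j == j') && (b != b')
  end.

Lemma M_adj_sym : symmetric M_adj.
Proof.
move=> [i|[j b]] [i'|[j' b']] //=; rewrite eq_sym //.
by rewrite [b == b']eq_sym.
Qed.

Lemma M_adj_irrefl : irreflexive M_adj.
Proof. by move=> [i|[j b]] /=; rewrite !eqxx. Qed.

Definition M : sgraph := SGraph M_adj_sym M_adj_irrefl.

Lemma card_M : odd n -> (3 <= n)%N -> #|M| = n.
Proof.
move=> odd_n n_ge3; rewrite card_sum card_prod !card_ord card_bool muln2.
have even_n3 : ~~ odd (n - 3) by rewrite oddB ?odd_n.
by rewrite even_halfK // subnKC.
Qed.

End MGraph.

(* Main.v *)
Require Import Defs.
From mathcomp Require Import all_boot all_order all_algebra.
From mathcomp Require Import complex.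
From mathcomp Require classical_sets.
From mathcomp Require Import boolp reals.
From mathcomp Require Import zify ring lra.

(* In a well-covered graph of odd order that consists of one cycle with trees
   attached, follow a longest path leaving the cycle.  If it has length at least
   2, it ends with u, s, l where l is a leaf and s has degree 2, and deleting s
   and l leaves a graph H of the same kind.  Otherwise there are at most pendant
   vertices around the cycle; exchanging vertices of maximal independent sets
   then shows that the order is even unless the graph is a bare cycle, which
   must have length 3, 5 or 7.  Writing m_k = (1+2x)^(k+1) + x(1+x)^k for the
   independence polynomial of M_(2k+3), one has
     I(G) = (1+x) I(H) + x I(H-u),    m_k = (1+x) m_(k-1) + x (1+2x)^k,
   so by induction on the order it suffices to bound I(H-u) above by (1+2x)^k.
   As I(H) >= m_(k-1) > 0 on the interval considered, all induced subgraphs of H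
   have positive independence polynomials there, so deleting vertices or edges
   increases I, and the bound follows by peeling off the attached edges. *)

Set Implicit Arguments.
Unset Strict Implicit.
Unset Printing Implicit Defensive.

Import Order.TTheory GRing.Theory Num.Theory.
Local Open Scope ring_scope.

(** * Independence polynomials of induced subgraphs *)

Section InducedPolynomial.
Variables (R : realType) (G : sgraph).
Implicit Types (A B S : {set G}) (v : G) (x : R).

Definition nbhd v : {set G} := [set y | adj v y].

(** Indexed by vertex subsets of the fixed graph [G], so that deleting vertices never changes the
    ambient type. *)
Definition ip A : {poly R} :=
  \sum_(S : {set G} | independent S && (S \subset A)) 'X^#|S|.

Lemma independentP S :
  reflect {in S &, forall y z, ~~ adj y z} (independent S).
Proof.
apply: (iffP forall_inP) => [h y z yS zS|h y yS].
  by have /forall_inP := h y yS; apply.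
by apply/forall_inP => z zS; apply: h.
Qed.

Lemma independentS A B : A \subset B -> independent B -> independent A.
Proof.
move=> /subsetP sAB /independentP iB.
by apply/independentP => y z /sAB yB /sAB; apply: iB.
Qed.

Lemma independent0 : independent (set0 : {set G}).
Proof. by apply/independentP => y z; rewrite inE. Qed.

Lemma independentU1 v S :
  independent (v |: S) = independent S && [disjoint nbhd v & S].
Proof.
apply/independentP/andP => [h|[/independentP iS dS] y z].
  split; first by apply/independentP => y z yS zS; apply: h; rewrite inE ?yS ?zS orbT.
  rewrite disjoints_subset; apply/subsetP => y; rewrite !inE => avy.
  by apply: contraL avy => yS; apply: h; rewrite !inE ?eqxx // yS orbT.
have nav w : w \in S -> ~~ adj v w.
  by move=> wS; apply: contraTN wS => avw; rewrite (disjointFr dS) // inE.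
rewrite !inE => /predU1P[->|yS] /predU1P[->|zS]; rewrite ?adj_irrefl ?nav //.
  by rewrite adj_sym nav.
exact: iS.
Qed.

Lemma ip0 : ip set0 = 1.
Proof.
rewrite /ip (big_pred1 set0) ?cards0 ?expr0 // => S /=.
by rewrite subset0; case: eqP => [->|_]; rewrite ?andbF // independent0.
Qed.

Lemma ip_at0 A : (ip A).[0] = 1.
Proof.
rewrite /ip horner_sum (bigD1 set0) /=; last by rewrite independent0 sub0set.
rewrite cards0 expr0 hornerE big1 ?addr0 // => S /andP[_ nS].
by rewrite hornerXn expr0n cards_eq0 (negPf nS).
Qed.

(** Removing [v] turns the independent sets containing it into those avoiding its closed
    neighbourhood, which gives the second term. *)
Lemma ip_rec v A : v \in A ->
  ip A = ip (A :\ v) + 'X * ip ((A :\ v) :\: nbhd v).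
Proof.
move=> vA; rewrite /ip (bigID (fun S : {set G} => v \in S)) /= addrC; congr (_ + _).
  by apply: eq_bigl => S; rewrite subsetD1 andbA.
rewrite mulr_sumr (reindex_onto (fun S => v |: S) (fun S => S :\ v)); last first.
  by move=> S /andP[_ vS]; rewrite setD1K.
apply: eq_big => S.
  rewrite setU11 andbT independentU1 subUset sub1set vA /= subsetD subsetD1.
  have -> : ((v |: S) :\ v == S) = (v \notin S).
    apply/eqP/idP => [<-|nvS]; first by rewrite !inE eqxx.
    by rewrite setU1K.
  by rewrite disjoint_sym; do !case: (_ \subset _); do !case: (independent _);
     do !case: (_ \in _); case: [disjoint _ & _].
move=> /andP[_ /eqP h]; have nvS : v \notin S by rewrite -h !inE eqxx.
by rewrite cardsU1 nvS exprS.
Qed.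

Lemma horner_ip_rec v A x : v \in A ->
  (ip A).[x] = (ip (A :\ v)).[x] + x * (ip ((A :\ v) :\: nbhd v)).[x].
Proof. by move=> vA; rewrite (ip_rec vA) hornerD hornerM hornerX. Qed.

Lemma indep_poly_ip : indep_poly G R = ip setT.
Proof.
rewrite /indep_poly poly_def /ip /num_indep.
transitivity (\sum_(k < #|G|.+1)
    \sum_(S : {set G} | independent S && (#|S| == k)) ('X^#|S| : {poly R})).
  apply: eq_bigr => k _.
  rewrite -sum1_card natr_sum scaler_suml; apply: eq_big => S; rewrite ?inE //.
  by move=> /andP[_ /eqP->]; rewrite scale1r.
rewrite (partition_big (fun S : {set G} => inord #|S| : 'I_#|G|.+1) xpredT) //=.
apply: eq_bigr => k _; apply: eq_bigl => S; rewrite subsetT andbT.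
by congr (_ && _); rewrite -val_eqE /= inordK // ltnS max_card.
Qed.

Lemma horner_ip_isolated v A x : v \in A -> {in A, forall y, ~~ adj v y} ->
  (ip A).[x] = (1 + x) * (ip (A :\ v)).[x].
Proof.
move=> vA nA; rewrite (horner_ip_rec _ vA).
have -> : (A :\ v) :\: nbhd v = A :\ v.
  apply/setDidPl; rewrite disjoints_subset; apply/subsetP => y.
  by rewrite !inE => /andP[_ /nA].
by ring.
Qed.

(** Branch on [s] rather than on the leaf: without [s] the leaf is isolated and gives the factor
    [1 + x]; once [s] is chosen, the leaf is excluded as well. *)
Lemma horner_ip_leaf s l A x : s \in A -> l \in A -> s != l ->
  {in A, forall y, adj l y = (y == s)} ->
  (ip A).[x] = (1 + x) * (ip (A :\ l :\ s)).[x]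
               + x * (ip ((A :\ l :\ s) :\: nbhd s)).[x].
Proof.
move=> sA lA sl nl; have asl : adj s l by rewrite adj_sym nl.
rewrite (horner_ip_rec _ sA) (@horner_ip_isolated l); last first.
- by move=> y; rewrite !inE => /andP[ys yA]; rewrite nl.
- by rewrite !inE eq_sym sl.
congr ((1 + x) * (ip _).[x] + x * (ip _).[x]).
  by rewrite !setDDl setUC.
apply/setP => y; rewrite !inE; case: (eqVneq y l) => [->|//].
by rewrite asl.
Qed.

Lemma horner_ip_independent A x : independent A -> (ip A).[x] = (1 + x) ^+ #|A|.
Proof.
have [n] := ubnP #|A|; elim: n A => // n IH A ltAn iA.
have [->|[v vA]] := set_0Vmem A; first by rewrite ip0 hornerE cards0.
have cA := cardsD1 v A; rewrite vA in cA.
rewrite (@horner_ip_isolated v) //; last first.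
  by move=> y yA; move/independentP: iA; apply.
rewrite IH; [by rewrite cA exprS| by lia|].
by apply: independentS iA; apply: subsetDl.
Qed.

(** The hypotheses make [A] a disjoint union of copies of K_2, each contributing [1 + 2 * x]; that
    [f] is an involution on [A] follows from the symmetry of [adj]. *)
Lemma horner_ip_perfect_matching (f : G -> G) k A x : #|A| = k.*2 ->
  {in A, forall y, f y \in A} ->
  {in A &, forall y z, adj y z = (z == f y)} ->
  (ip A).[x] = (1 + 2 * x) ^+ k.
Proof.
elim: k A => [|k IH] A cA fA adjA.
  by rewrite (cards0_eq cA) ip0 hornerE.
have [v vA] : exists v, v \in A by apply/card_gt0P; rewrite cA.
set w := f v; have wA : w \in A by apply: fA.
have avw : adj v w by rewrite adjA.
have fw : f w = v by apply/esym/eqP; rewrite -adjA // adj_sym.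
have wv : v != w by apply: contraTneq avw => <-; rewrite adj_irrefl.
have nb : {in A, forall y, adj w y = (y == v)} by move=> y yA; rewrite adjA // fw.
rewrite (@horner_ip_leaf v w) //.
have -> : (A :\ w :\ v) :\: nbhd v = A :\ w :\ v.
  apply/setDidPl; rewrite disjoints_subset; apply/subsetP => y.
  by rewrite !inE => /and3P[_ yw yA]; rewrite adjA.
have cA' := cardsD1 w A; rewrite wA in cA'.
have cA'' := cardsD1 v (A :\ w); rewrite !inE wv vA /= in cA''.
rewrite IH; first by rewrite exprS; ring.
- by lia.
- move=> y; rewrite !inE => /and3P[yv yw yA].
  have ay : adj y (f y) by rewrite adjA ?fA ?eqxx.
  rewrite fA // andbT; apply/andP; split; apply: contraNneq yv => fy.
    by move: ay; rewrite fy adj_sym adjA // => /eqP yw'; rewrite yw' eqxx in yw.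
  by move: ay; rewrite fy adj_sym nb.
- by move=> y z; rewrite !inE => /and3P[_ _ yA] /and3P[_ _ zA]; apply: adjA.
Qed.

(** Split off a root [r] given by the intermediate value theorem. If the cofactor is nonpositive
    somewhere in [(r, 0]], it supplies by induction on the size a root further right; otherwise [r]
    is already the largest one. *)
Lemma largest_root_le0 (q : {poly R}) y : y <= 0 -> q.[y] <= 0 -> 0 < q.[0] ->
  exists b, [/\ y <= b, b < 0, q.[b] = 0 & forall x, b < x <= 0 -> 0 < q.[x]].
Proof.
have [n] := ubnP (size q); elim: n q y => // n IH q y ltqn y0 qy q0.
have [r /andP[yr r0] /eqP qr] : exists2 r, y <= r <= 0 & root q r.
  by apply: poly_ivt => //; rewrite qy ltW.
have {}r0 : r < 0.
  by rewrite lt_neqAle r0 andbT; apply: contraTneq q0 => r_0; move: qr; rewrite r_0 => ->; rewrite ltxx.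
have [q' eq'] : exists q', q = q' * ('X - r%:P) by apply/factor_theorem/eqP.
have hq x : q.[x] = q'.[x] * (x - r) by rewrite eq' !hornerE.
have q'0 : 0 < q'.[0] by move: q0; rewrite hq sub0r pmulr_lgt0 // oppr_gt0.
have [h|/existsNP[y' /not_implyP[/andP[ry' y'0] /negP]]] :=
    pselect (forall x, r < x <= 0 -> 0 < q'.[x]).
  exists r; split => // x /[dup] /h q'x /andP[rx _].
  by rewrite hq mulr_gt0 // subr_gt0.
rewrite -leNgt => q'y'.
have q'n0 : q' != 0 by apply: contraTneq q'0 => ->; rewrite horner0 ltxx.
have [|b [y'b b0 q'b hb]] := IH q' y' _ y'0 q'y' q'0.
  move: ltqn; rewrite eq' size_Mmonic ?monicXsubC // size_XsubC.
  by lia.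
exists b; split => //; first by apply: le_trans yr _; apply: le_trans (ltW ry') _.
  by rewrite hq q'b mul0r.
move=> x /[dup] /hb q'x /andP[bx _]; rewrite hq mulr_gt0 // subr_gt0.
by apply: lt_trans ry' _; apply: le_lt_trans y'b _.
Qed.

(* If I(A - v) had a largest root b in the interval, then
   I(A)(b) = b I(A - N[v])(b) <= 0. *)
Lemma ip_gt0_D1 v A a :
  (forall b, (forall x, b <= x <= 0 -> 0 < (ip (A :\ v)).[x]) ->
     forall x, b <= x <= 0 -> 0 < (ip ((A :\ v) :\: nbhd v)).[x]) ->
  v \in A -> (forall x, a <= x <= 0 -> 0 < (ip A).[x]) ->
  forall x, a <= x <= 0 -> 0 < (ip (A :\ v)).[x].
Proof.
move=> IH vA hA x /andP[ax x0]; rewrite ltNge; apply/negP => qx.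
have [|b [xb b0 qb hb]] := largest_root_le0 x0 qx; first by rewrite ip_at0.
set N := (A :\ v) :\: nbhd v in IH.
have Npos y : b < y <= 0 -> 0 < (ip N).[y].
  case/andP=> biy y0; apply: (IH y); last by rewrite lexx.
  by move=> z /andP[yz z0]; apply: hb; rewrite (lt_le_trans biy).
have Nb : 0 <= (ip N).[b].
  rewrite leNgt; apply/negP => Nb.
  have [|r /andP[br r0] /eqP Nr] := @poly_ivt _ (ip N) b 0 (ltW b0).
    by rewrite ltW // ip_at0 ler01.
  have : 0 < (ip N).[r].
    apply: Npos; rewrite r0 andbT lt_neqAle br andbT.
    by apply: contraTneq Nb => ->; rewrite Nr ltxx.
  by rewrite Nr ltxx.
have : 0 < (ip A).[b] by apply: hA; rewrite (le_trans ax) //= ltW.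
rewrite (horner_ip_rec _ vA) qb add0r -/N; nra.
Qed.

(** Vertices outside [B] are deleted one at a time. The left end [a] is general in the induction
    because [ip_gt0_D1] needs the claim for [A :\ v] on intervals with other left ends. *)
Lemma ip_gt0_sub A B a : B \subset A ->
  (forall x, a <= x <= 0 -> 0 < (ip A).[x]) ->
  forall x, a <= x <= 0 -> 0 < (ip B).[x].
Proof.
have [n] := ubnP #|A|; elim: n A B a => // n IH A B a ltAn sBA hA.
have [->//|nBA] := eqVneq B A.
have [v vA vB] : exists2 v, v \in A & v \notin B.
  by apply/subsetPn; apply: contra nBA; rewrite eqEsubset sBA.
have cA := cardsD1 v A; rewrite vA in cA.
apply: (IH (A :\ v)); [by lia|by rewrite subsetD1 sBA|].
apply: ip_gt0_D1 => // b; apply: IH; [by lia|exact: subsetDl].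
Qed.

Definition ip_pos A x := forall B, B \subset A -> 0 < (ip B).[x].

Lemma ip_posS A B x : B \subset A -> ip_pos A x -> ip_pos B x.
Proof. by move=> sBA pA D sDB; apply/pA/(subset_trans sDB). Qed.

(** By the recurrence, deleting a vertex changes the value by [- x] times a positive number. *)
Lemma ip_anti A B x : x <= 0 -> ip_pos A x -> B \subset A ->
  (ip A).[x] <= (ip B).[x].
Proof.
move=> x0; have [n] := ubnP #|A|; elim: n A => // n IH A ltAn pA sBA.
have [->//|nBA] := eqVneq B A.
have [v vA vB] : exists2 v, v \in A & v \notin B.
  by apply/subsetPn; apply: contra nBA; rewrite eqEsubset sBA.
have cA := cardsD1 v A; rewrite vA in cA.
apply: (@le_trans _ _ (ip (A :\ v)).[x]); last first.
  apply: IH; [by lia|by apply: ip_posS pA; apply: subsetDl|].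
  by rewrite subsetD1 sBA.
rewrite (horner_ip_rec _ vA) gerDl mulr_le0_ge0 // ltW // pA //.
by apply: (subset_trans (subsetDl _ _)); apply: subsetDl.
Qed.

(** The bound comes from erasing the edges at [v], which then counts as an isolated vertex. *)
Lemma ip_le_D1 v A x : x <= 0 -> ip_pos A x -> v \in A ->
  (ip A).[x] <= (1 + x) * (ip (A :\ v)).[x].
Proof.
move=> x0 pA vA; rewrite (horner_ip_rec _ vA).
have p' : ip_pos (A :\ v) x by apply: ip_posS pA; apply: subsetDl.
have := ip_anti x0 p' (subsetDl _ (nbhd v)); nra.
Qed.

(** The bound comes from cutting the edge [a]-[b] off the rest of [A]: a separate K_2 contributes
    [1 + 2 * x]. *)
Lemma ip_le_edge a b A x : x <= 0 -> ip_pos A x -> a \in A -> b \in A ->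
  adj a b -> (ip A).[x] <= (1 + 2 * x) * (ip (A :\ a :\ b)).[x].
Proof.
move=> x0 pA aA bA ab.
have ba : b != a by apply: contraTneq ab => ->; rewrite adj_irrefl.
have p1 : ip_pos (A :\ a) x by apply: ip_posS pA; apply: subsetDl.
have p2 : ip_pos (A :\ a :\ b) x by apply: ip_posS p1; apply: subsetDl.
rewrite (horner_ip_rec _ aA) (@horner_ip_rec b (A :\ a)) ?inE ?ba //.
have := ip_anti x0 p2 (subsetDl _ (nbhd b)).
have : (ip (A :\ a :\ b)).[x] <= (ip ((A :\ a) :\: nbhd a)).[x].
  apply: ip_anti => //; rewrite subsetD1 subsetDl /=.
  by rewrite !inE ab.
nra.
Qed.

End InducedPolynomial.

(** * Structure of well-covered unicyclic graphs of odd order *)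

Section WellCovered.
Variable G : sgraph.
Implicit Types (A S T X : {set G}).

Definition dominates S A := {in A, forall v, v \notin S -> exists2 z, z \in S & adj z v}.

(** A maximal independent set of [A] appears as an independent dominating one; letting [T] be any
    independent set spares extending it. *)
Definition well_covered_in A := forall S T, independent S -> S \subset A -> dominates S A ->
  independent T -> T \subset A -> (#|T| <= #|S|)%N.

Lemma extend_independent A X : independent X -> X \subset A ->
  exists S, [/\ X \subset S, independent S, S \subset A & dominates S A].
Proof.
move=> iX sXA.
have [|S /maxsetP[/andP[iS sSA] maxS] sXS] :=
    @maxset_exists _ (fun S => independent S && (S \subset A)) X.
  by rewrite iX.
exists S; split => // v vA vS.
have [/existsP[z /andP[zS azv]]|/existsPn h] := boolP [exists z, (z \in S) && adj z v].
  by exists z.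
suff eqS : v |: S = S by rewrite -eqS setU11 in vS.
apply: maxS; last exact: subsetUr.
rewrite independentU1 iS subUset sub1set vA sSA !andbT /=.
rewrite disjoint_sym disjoints_subset; apply/subsetP => z zS; rewrite !inE adj_sym.
by have := h z; rewrite zS.
Qed.

Lemma wc_setT : well_covered G -> well_covered_in [set: G].
Proof.
move=> wcG S T iS _ dS iT _.
have [T' [sTT' iT' _ dT']] := extend_independent iT (subsetT T).
have maxI U : independent U -> dominates U setT -> maximal_independent U.
  move=> iU dU; apply/maxsetP; split => // W /independentP iW sUW.
  apply/eqP; rewrite eqEsubset sUW andbT; apply/subsetP => v vW.
  apply: contraT => /(dU v (in_setT v))[z /(subsetP sUW) zW].
  by rewrite (negPf (iW z v zW vW)).
rewrite (wcG S T') ?maxI //; exact: subset_leq_card.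
Qed.

(** Adding [l] to an independent dominating set of the rest gives one of [A], since [l] dominates
    [s]; both sizes compared grow by one. *)
Lemma wc_delete_leaf A s l : well_covered_in A -> s \in A -> l \in A -> s != l ->
  {in A, forall y, adj l y = (y == s)} -> well_covered_in (A :\ l :\ s).
Proof.
move=> wcA sA lA sl nl S T iS sSA dS iT sTA.
have sub (U : {set G}) : U \subset A :\ l :\ s -> l |: U \subset A.
  move=> sU; rewrite subUset sub1set lA (subset_trans sU) //.
  by rewrite (subset_trans (subsetDl _ _)) // subsetDl.
have lU (U : {set G}) : U \subset A :\ l :\ s -> l \notin U.
  by move=> /subsetP sU; apply/negP => /sU; rewrite !inE eqxx andbF.
have indep (U : {set G}) : U \subset A :\ l :\ s -> independent U -> independent (l |: U).
  move=> sU iU; rewrite independentU1 iU disjoint_sym disjoints_subset.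
  apply/subsetP => y /(subsetP sU); rewrite !inE => /and3P[ys _ yA].
  by rewrite nl.
have : (#|l |: T| <= #|l |: S|)%N.
  apply: wcA; rewrite ?sub ?indep //.
  move=> v vA; rewrite !inE negb_or => /andP[vl vS].
  have [->|vs] := eqVneq v s; first by exists l; rewrite ?setU11 ?nl.
  have [|z zS azv] := dS v _ vS; first by rewrite !inE vs vl.
  by exists z => //; rewrite inE zS orbT.
by rewrite !cardsU1 !lU // !add1n ltnS.
Qed.

(* Any maximal independent set containing X and a could be enlarged by trading
   a for b and d. *)
Lemma wc_exchange A X a b d : well_covered_in A ->
  independent (a |: X) -> a |: X \subset A -> b \in A -> d \in A ->
  adj a b -> adj a d -> b != d -> ~~ adj b d ->
  {in A, forall y, adj b y || adj d y -> y != a ->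
     exists2 z, z \in a |: X & adj z y} ->
  False.
Proof.
move=> wcA iX sXA bA dA ab ad bd nbd dom.
have [S [sXS iS sSA dS]] := extend_independent iX sXA.
have aS : a \in S by apply: (subsetP sXS); rewrite setU11.
move/independentP: (iS) => iS'.
have nS z : adj a z -> z \notin S.
  by move=> az; apply/negP => zS; have := iS' a z aS zS; rewrite az.
(* By [dom], every neighbour of [b] or [d] other than [a] is adjacent to a vertex of [S], hence lies
   outside [S]. *)
have nb y : y \in S :\ a -> ~~ (adj b y || adj d y).
  rewrite !inE => /andP[ya yS]; apply/negP => h.
  have [z zX azy] := dom y (subsetP sSA _ yS) h ya.
  by have := iS' z y (subsetP sXS _ zX) yS; rewrite azy.
have iS1 : independent (S :\ a) by apply: independentS iS; apply: subsetDl.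
have iD : independent (d |: S :\ a).
  rewrite independentU1 iS1 disjoint_sym disjoints_subset.
  by apply/subsetP => y /nb; rewrite !inE negb_or => /andP[].
have iT : independent (b |: (d |: S :\ a)).
  rewrite independentU1 iD disjoint_sym disjoints_subset.
  apply/subsetP => y; rewrite !inE => /predU1P[->//|yS].
  by have := nb y; rewrite !inE negb_or => /(_ yS)/andP[].
have : (#|b |: (d |: S :\ a)| <= #|S|)%N.
  apply: wcA; rewrite ?subUset ?sub1set ?bA ?dA //.
  exact: subset_trans (subsetDl _ _) sSA.
by rewrite !cardsU1 !inE (negPf bd) (negPf (nS b ab)) (negPf (nS d ad)) !andbF /=
  (cardsD1 a S) aS !add1n ltnn.
Qed.

End WellCovered.

(** * Trees attached to the unique cycle, and their reduction to it *)

Section Unicyclic.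
Variables (G : sgraph) (c : seq G).
Hypothesis c_gt2 : (2 < size c)%N.
Hypothesis ucycle_c : ucycle (@adj G) c.
(** Uniqueness in terms of vertex sets: a cycle leaving [c], or missing a vertex of [c], is a
    contradiction. *)
Hypothesis only_cycle : forall c' : seq G,
  (2 < size c')%N -> ucycle (@adj G) c' -> c' =i c.
Implicit Types (A : {set G}) (p q : seq G).

Lemma uniq_c : uniq c. Proof. by case/andP: ucycle_c. Qed.
Lemma cycle_c : cycle (@adj G) c. Proof. by case/andP: ucycle_c. Qed.

Lemma adj_neq (x y : G) : adj x y -> x != y.
Proof. by apply: contraTneq => ->; rewrite adj_irrefl. Qed.

(** A chord from [x] to [y] would close the arc between them into a cycle missing the vertex that
    follows [y]. *)
Lemma chordless x y : x \in c -> y \in c -> adj x y ->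
  y = next c x \/ x = next c y.
Proof.
move=> /rot_to[i c' def_c] yc axy.
rewrite -!(next_rot i uniq_c).
have uc' : ucycle (@adj G) (x :: c') by rewrite -def_c rot_ucycle.
have only' z : (z \in c) = (z \in x :: c') by rewrite -def_c mem_rot.
move: yc; rewrite only' inE eq_sym (negPf (adj_neq axy)) /= => yc'.
rewrite def_c; case/splitPr: yc' uc' only' => [c1 c2] /andP[cyc uni] only'.
case: c1 => [|z c1] in cyc uni only' *; first by left; rewrite /= eqxx.
right; move: cyc uni only'; rewrite -cat_rcons.
have : (1 < size (rcons (z :: c1) y))%N by rewrite size_rcons.
have : last x (rcons (z :: c1) y) = y by rewrite last_rcons.
set q := rcons _ y => lq sq cyc uni only'.
have uq : uniq (x :: q) by move: uni; rewrite -cat_cons cat_uniq => /and3P[].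
have uc1 : ucycle (@adj G) (x :: q).
  rewrite /ucycle uq andbT -[cycle _ _]/(path _ x (rcons q x)) rcons_path lq.
  rewrite adj_sym axy andbT; move: cyc.
  by rewrite -[cycle _ _]/(path _ x (rcons (q ++ c2) x)) rcons_cat cat_path => /andP[].
have eqc := @only_cycle (x :: q) sq uc1.
case: c2 => [|t c2] in cyc uni only' *.
  by rewrite cats0 -lq next_nth mem_last index_last // nth_default.
have : t \in x :: q by rewrite eqc only' !(inE, mem_cat) eqxx !orbT.
move: uni; rewrite -cat_cons cat_uniq => /and3P[_ /hasPn/(_ t)].
by rewrite inE eqxx => /(_ isT)/negPf->.
Qed.

(** The list [p] omits the vertex [x] where the path leaves the cycle, so [size p] counts edges; it
    may be empty. *)
Definition tail A x p :=
  [&& x \in c, path (@adj G) x p, uniq p & all (fun y => (y \in A) && (y \notin c)) p].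

(** Any other neighbour [w] of [v] on the tail or on the cycle would close a second cycle through
    [v], which lies off [c]. *)
Lemma tail_nbr A x q v w : tail A x (rcons q v) -> (w \in c) || (w \in q) ->
  adj v w -> w = last x q.
Proof.
case/and4P => xc pq uq allq wcq avw.
have vc : v \notin c.
  by move/allP: allq => /(_ v); rewrite mem_rcons mem_head => /(_ isT)/andP[].
have nocycle p : (2 < size p)%N -> ucycle (@adj G) p -> v \in p -> False.
  by move=> sp up vp; move: vc; rewrite -(only_cycle sp up) vp.
have qc y : y \in rcons q v -> y \notin c.
  by move=> yq; move/allP: allq => /(_ y yq)/andP[].
have [wq|wq] := boolP (w \in q).
  case/splitPr: wq pq uq nocycle qc => [q1 q2] pq uq nocycle qc.
  case: q2 => [|z q2] in pq uq nocycle qc *; first by rewrite last_cat.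
  case: (nocycle (w :: rcons (z :: q2) v)).
  - by rewrite /= size_rcons.
  - move: pq uq; rewrite rcons_cat cat_path cat_uniq.
    case/andP=> _ /andP[_ pw] /and3P[_ _ uw]; rewrite /ucycle [uniq _]uw andbT.
    by rewrite -[cycle _ _]/(path _ w (rcons (rcons (z :: q2) v) w)) rcons_path
       last_rcons avw andbT.
  - by rewrite in_cons mem_rcons mem_head orbT.
rewrite (negPf wq) orbF in wcq.
have [wx|wx] := eqVneq w x.
  case: q => [|z q] in pq uq allq nocycle qc wq *; first by [].
  case: (nocycle (x :: rcons (z :: q) v)).
  - by rewrite /= size_rcons.
  - rewrite /ucycle -[cycle _ _]/(path _ x (rcons (rcons (z :: q) v) x)).
    rewrite rcons_path pq last_rcons -wx avw cons_uniq uq.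
    by rewrite wx !andbT; apply/negP => /qc; rewrite xc.
  - by rewrite in_cons mem_rcons mem_head orbT.
have [i c' def_c] := rot_to xc.
have well_covered_in' : w \in c' by move: wcq; rewrite -(mem_rot i) def_c inE (negPf wx).
have inc y : (y \in c) = (y \in x :: c') by rewrite -def_c mem_rot.
have uc' : ucycle (@adj G) (x :: c') by rewrite -def_c rot_ucycle.
case/splitPr: well_covered_in' inc uc' => [c1 c2] inc /andP[cyc uni].
(* Follow [c] from [w] to [x], then the tail out to [v], and return along the edge from [v] to
   [w]. *)
case: (nocycle (w :: c2 ++ x :: rcons q v)).
- by rewrite /= size_cat /= size_rcons !addnS.
- move: cyc; rewrite -[cycle _ _]/(path _ x (rcons (c1 ++ w :: c2) x)) rcons_cat cat_path.
  case/andP=> _ pw; have : path (@adj G) w (rcons c2 x) by case/andP: pw.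
  rewrite rcons_path => /andP[pc2 lx].
  move: uni; rewrite -[uniq _]/(uniq ((x :: c1) ++ w :: c2)) cat_uniq.
  case/and3P=> _ /hasPn xc1 uc2.
  have uxc2 : uniq (w :: c2 ++ [:: x]).
    rewrite -cat_cons cats1 rcons_uniq uc2 andbT; apply/negP => /xc1.
    by rewrite mem_head.
  rewrite /ucycle -[cycle _ _]/(path _ w (rcons (c2 ++ x :: rcons q v) w)) rcons_cat.
  rewrite cat_path pc2 /= lx rcons_path pq last_rcons avw /=.
  rewrite -[_ && _]/(uniq (w :: c2 ++ [:: x] ++ rcons q v)) catA -cat_cons cat_uniq uxc2 uq.
  rewrite andbT; apply/hasPn => y /qc; apply: contra.
  rewrite inE mem_cat inE => h; rewrite inc inE mem_cat inE.
  by case/or3P: h => ->; rewrite ?orbT.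
- by rewrite !(inE, mem_cat, mem_rcons) eqxx !orbT.
Qed.

(** Numbering the cycle from [s] turns adjacency on it into arithmetic on indices. *)
Lemma cycle_param s : s \in c -> exists v : nat -> G,
  [/\ v 0%N = s,
      forall y, y \in c -> exists2 i, (i < size c)%N & y = v i,
      forall i, (i < size c)%N -> v i \in c,
      forall i, (i.+1 < size c)%N -> v i.+1 = next c (v i) &
      forall i j, (i < size c)%N -> (j < size c)%N ->
        (v i == v j) = (i == j) /\
        adj (v i) (v j) = [|| j == i.+1, i == j.+1,
          (i == 0%N) && (j == (size c).-1) | (j == 0%N) && (i == (size c).-1)]].
Proof.
move=> /rot_to[k c' def_c].
have sz : size c = (size c').+1 by rewrite -(size_rot k) def_c.
have inc y : (y \in c) = (y \in s :: c') by rewrite -def_c mem_rot.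
have uc' : uniq (s :: c') by rewrite -def_c rot_uniq uniq_c.
pose v i := nth s (s :: c') i.
have vc i : (i < size c)%N -> v i \in c by rewrite sz inc => lti; apply: mem_nth.
have nextv i : (i < size c)%N -> next c (v i) = if (i.+1 < size c)%N then v i.+1 else s.
  move=> lti; have lti' : (i < size (s :: c'))%N by rewrite /= -sz.
  rewrite -(next_rot k uniq_c) def_c next_nth mem_nth // index_uniq //.
  by case: ltnP => // le; apply: nth_default; rewrite -ltnS -sz.
have eqv i j : (i < size c)%N -> (j < size c)%N -> (v i == v j) = (i == j).
  by move=> lti ltj; apply: nth_uniq; rewrite /= -?sz.
have v0 : s = v 0%N by [].
exists v; split=> //.
- move=> y; rewrite inc => yc; exists (index y (s :: c')); last by rewrite /v nth_index.
  by rewrite sz index_mem.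
- by move=> i lti; rewrite nextv ?lti //; apply: ltn_trans lti.
move=> i j lti ltj; split; first exact: eqv.
have nextP i' j' : (i' < size c)%N -> (j' < size c)%N ->
    (v j' == next c (v i')) = (j' == i'.+1) || (j' == 0%N) && (i' == (size c).-1).
  move=> lti' ltj'; rewrite nextv //; case: ltnP => h.
    by rewrite eqv //; lia.
  by rewrite v0 eqv //; lia.
have -> : adj (v i) (v j) = (v j == next c (v i)) || (v i == next c (v j)).
  apply/idP/orP => [|[/eqP->|/eqP->]].
  - by case/chordless; rewrite ?vc // => ->; rewrite eqxx; [left|right].
  - by apply: next_cycle; [apply: cycle_c|apply: vc].
  - by rewrite adj_sym; apply: next_cycle; [apply: cycle_c|apply: vc].
by rewrite !nextP //; lia.
Qed.

Let C : {set G} := [set x in c].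

Lemma card_C : #|C| = size c.
Proof. by rewrite cardsE; apply/card_uniqP/uniq_c. Qed.

(** In a longer cycle [v 3] can be traded for [v 2] and [v 4]: their other neighbours [v 1] and
    [v 5] are dominated by [v 0] and [v 6], which are nonadjacent from length 8 on. *)
Lemma wc_cycle_lt : odd (size c) -> well_covered_in C -> (size c < 8)%N.
Proof.
move=> odd_c wcC; rewrite ltnNge; apply/negP => c_ge8.
have [s sc] : exists s, s \in c by case: (c) c_gt2 => // s c' _; exists s; rewrite mem_head.
have [v [_ vP vc _ vadj]] := cycle_param sc.
have vC i : (i < size c)%N -> v i \in C by move=> lti; rewrite inE vc.
have veq i j : (i < size c)%N -> (j < size c)%N -> (v i == v j) = (i == j).
  by move=> lti ltj; case: (vadj i j lti ltj).
have {}vadj i j : (i < size c)%N -> (j < size c)%N -> _ :=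
  fun lti ltj => (vadj i j lti ltj).2.
apply: (@wc_exchange _ C [set v 0%N; v 6] (v 3) (v 2) (v 4)) => //.
- apply/independentP => y z; rewrite !inE.
  by move=> /or3P[]/eqP-> /or3P[]/eqP->; rewrite vadj; lia.
- by apply/subsetP => y; rewrite !inE => /or3P[]/eqP->; apply: vc; lia.
- by apply: vC; lia.
- by apply: vC; lia.
- by rewrite vadj; lia.
- by rewrite vadj; lia.
- by rewrite veq; lia.
- by rewrite vadj; lia.
move=> y; rewrite inE => /vP[j ltj ->]; rewrite !vadj ?veq; try lia.
move=> h1 h2; have [j1|j5] : j = 1%N \/ j = 5%N by lia.
  by exists (v 0%N); rewrite ?inE ?eqxx ?orbT // vadj; lia.
by exists (v 6%N); rewrite ?inE ?eqxx ?orbT // vadj; lia.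
Qed.

(** The deletions of a leaf and its neighbour of degree 2, read backwards, so that bounds on
    polynomials can go by structural induction. *)
Inductive built : {set G} -> Prop :=
| built_cycle : built C
| built_add H u s l : built H -> u \in H -> s \notin H -> l \notin H ->
    adj s l -> {in H, forall y, adj s y = (y == u)} ->
    {in H, forall y, ~~ adj l y} -> built (l |: (s |: H)).

(* Connectedness of the subgraph induced by A, which contains C. *)
Definition reach A := forall B : {set G}, C \subset B -> B \proper A ->
  exists2 b, b \in B & exists2 y, y \in A :\: B & adj b y.

(** If [u] is in [B], use [reach] on [B] enlarged by [s] and [l], which have no neighbour in [A]
    outside that set. Otherwise use it on [B] itself, from which no edge goes to [s] or [l]. *)
Lemma reach_delete A u s l : C \subset A :\ l :\ s -> reach A ->
  s \in A -> l \in A -> s != l -> adj s l ->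
  {in A, forall y, adj l y = (y == s)} ->
  {in A, forall y, adj s y -> y != l -> y = u} -> reach (A :\ l :\ s).
Proof.
move=> sCA rA sA lA sl asl nl ns B sCB /properP[/subsetP sBA [w wA wB]].
have sBA' y : y \in B -> [/\ y != s, y != l & y \in A].
  by move=> /sBA; rewrite !inE => /and3P[-> -> ->].
have lB : l \notin B by apply/negP => /sBA'[]; rewrite eqxx.
have sB : s \notin B by apply/negP => /sBA'[]; rewrite eqxx.
move: wA; rewrite !inE => /and3P[ws wl wA].
have [uB|uB] := boolP (u \in B).
  have [||b bB [y]] := rA (l |: (s |: B)).
  - by rewrite (subset_trans sCB) // setUA subsetUr.
  - apply/properP; split; last by exists w; rewrite // !inE !negb_or wl ws.
    by rewrite !subUset !sub1set lA sA; apply/subsetP => y /sBA'[].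
  rewrite !inE !negb_or => /andP[/and3P[yl ys yB] yA] aby.
  exists b; last by exists y; rewrite // !inE yB ys yl.
  move: bB; rewrite !inE => /or3P[/eqP bl|/eqP bs|//].
    by move: aby; rewrite bl nl // (negPf ys).
  by move: uB; rewrite -(ns y) // ?(negPf yB) // -bs.
have [||b bB [y]] := rA B => //.
  apply/properP; split; last by exists w.
  by apply/subsetP => y /sBA'[].
rewrite !inE => /andP[yB yA] aby; exists b => //; exists y => //.
have [bs bl bA] := sBA' b bB.
rewrite !inE yB yA andbT /=; apply/andP; split; apply: contraTneq aby => ->.
  by rewrite adj_sym; apply/negP => /ns -/(_ bA bl) bu; rewrite -bu bB in uB.
by rewrite adj_sym nl.
Qed.

Definition longest A n := (exists x p, tail A x p /\ size p = n) /\
  forall x p, tail A x p -> (size p <= n)%N.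

Lemma exists_longest A : exists n, longest A n.
Proof.
pose P n := [exists x, [exists t : n.-tuple G, tail A x t]].
have [x xc] : exists x, x \in c by case: (c) c_gt2 => // s c' _; exists s; rewrite mem_head.
have exP : exists n, P n.
  by exists 0%N; apply/existsP; exists x; apply/existsP; exists [tuple]; rewrite /tail xc.
have leP n : P n -> (n <= #|G|)%N.
  case/existsP => y /existsP[t /and4P[_ _ ut _]].
  by rewrite -(size_tuple t) -(card_uniqP ut) max_card.
case: (ex_maxnP exP leP) => n /existsP[y /existsP[t tt]] maxn.
exists n; split; first by exists y, t; rewrite size_tuple.
move=> z p tp; apply: maxn; apply/existsP; exists z; apply/existsP.
by exists (in_tuple p).
Qed.

(** A neighbour off the cycle and off the tail would lengthen the tail; the others fall under
    [tail_nbr]. *)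
Lemma longest_end A n x q v : longest A n -> tail A x (rcons q v) ->
  size (rcons q v) = n -> {in A, forall y, adj v y -> y = last x q}.
Proof.
case=> _ maxn tq sq y yA avy.
have [yq|] := boolP ((y \in c) || (y \in q)); first exact: tail_nbr tq yq avy.
rewrite negb_or => /andP[yc yq].
suff /maxn : tail A x (rcons (rcons q v) y) by rewrite size_rcons sq ltnn.
case/and4P: tq => xc pq uq allq; rewrite /tail xc rcons_path last_rcons pq avy.
rewrite rcons_uniq uq all_rcons allq yA yc mem_rcons inE negb_or yq !andbT /=.
by rewrite eq_sym adj_neq.
Qed.

Lemma independent1 (x : G) : independent [set x].
Proof. by apply/independentP => y z /set1P-> /set1P->; rewrite adj_irrefl. Qed.

Lemma independent2 (x y : G) : ~~ adj x y -> independent [set x; y].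
Proof.
move=> nxy; rewrite independentU1 independent1 disjoint_sym disjoints_subset.
by rewrite sub1set !inE.
Qed.

(** Two leaves at [s] could be traded for [s]. *)
Lemma wc_leaf_unique A s y z : well_covered_in A -> s \in A -> y \in A -> z \in A ->
  adj s y -> adj s z -> {in A, forall t, adj y t -> t = s} ->
  {in A, forall t, adj z t -> t = s} -> y = z.
Proof.
move=> wcA sA yA zA sy sz ny nz; apply/eqP; apply: contraT => yz.
case: (@wc_exchange _ A set0 s y z) => //.
- by rewrite setU0 independent1.
- by rewrite setU0 sub1set.
- by apply: contraTN sz => /ny->; rewrite ?adj_irrefl.
- by move=> t tA /orP[/ny->|/nz->] //; rewrite eqxx.
Qed.

(** Take the last vertices [u], [s], [l] of a longest tail, where [u] may lie on the cycle. A
    further neighbour of [s] would also end a longest tail, hence be a second leaf at [s]. *)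
Lemma detach A n : C \subset A -> well_covered_in A -> reach A -> longest A n -> (1 < n)%N ->
  exists u s l, [/\ [/\ u \in A :\ l :\ s, s \in A & l \in A],
    C \subset A :\ l :\ s, adj s l,
    {in A, forall y, adj l y = (y == s)} &
    {in A :\ l :\ s, forall y, adj s y = (y == u)}].
Proof.
move=> sCA wcA rA longA n1; case: (longA) => -[x [p [tp sp]]] _.
case/lastP: p => [|p l] in tp sp *; first by rewrite -sp in n1.
case/lastP: p => [|q s] in tp sp *; first by rewrite -sp in n1.
set u := last x q.
case/and4P: (tp) => xc pp up /allP allp.
have sq : s \in rcons (rcons q s) l by rewrite !(mem_rcons, inE) eqxx orbT.
have lq : l \in rcons (rcons q s) l by rewrite !(mem_rcons, inE) eqxx.
have [/andP[sA sc] /andP[lA lc]] := (allp s sq, allp l lq).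
have endp y : tail A x (rcons (rcons q s) y) ->
    y \in A /\ {in A, forall z, adj y z -> z = s}.
  move=> ty; split.
    case/and4P: ty => _ _ _ /allP/(_ y).
    by rewrite mem_rcons mem_head => /(_ isT)/andP[].
  move=> z zA ayz; rewrite -(last_rcons x q s).
  by apply: longest_end longA ty _ z zA ayz; rewrite -sp !size_rcons.
have [_ nl] := endp l tp.
move: (pp); rewrite !rcons_path last_rcons -/u => /andP[/andP[pq aus] asl].
have uA : u \in A.
  have := mem_last x q; rewrite -/u inE => /predU1P[->|uq].
    by apply: (subsetP sCA); rewrite inE.
  have uin : u \in rcons (rcons q s) l by rewrite !(mem_rcons, inE) uq !orbT.
  by case/andP: (allp u uin).
have nl' : {in A, forall y, adj l y = (y == s)}.
  by move=> y yA; apply/idP/eqP => [/nl->//|->]; rewrite adj_sym.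
have uql : uniq (rcons q s) /\ l \notin rcons q s.
  by move: up; rewrite rcons_uniq => /andP[-> ->].
have us : u != s by apply: adj_neq.
have ul : u != l.
  have := mem_last x q; rewrite -/u inE => /predU1P[->|uq].
    by apply: contraNneq lc => <-.
  by apply: contraTneq uq => ->; case: uql => _; rewrite mem_rcons inE => /norP[].
exists u, s, l; split => //.
- by rewrite !inE us ul uA.
- apply/subsetP => y yC; rewrite !inE (subsetP sCA _ yC) andbT.
  rewrite inE in yC.
  by apply/andP; split; apply: contraTneq yC => ->.
have tqs : tail A x (rcons q s).
  case: uql => uqs _; rewrite /tail xc rcons_path pq -/u aus uqs /=.
  by apply/allP => y yq; apply: allp; rewrite mem_rcons inE yq orbT.
move=> y; rewrite !inE => /and3P[ys yl yA]; apply/idP/eqP => [asy|->]; last by rewrite adj_sym.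
have [ycq|] := boolP ((y \in c) || (y \in q)); first exact: tail_nbr tqs ycq asy.
rewrite negb_or => /andP[yc yq].
have [|_ ny] := endp y.
  case/and4P: tqs => _ pqs uqs allqs.
  rewrite /tail xc rcons_path pqs last_rcons asy rcons_uniq uqs all_rcons allqs.
  by rewrite mem_rcons inE negb_or ys yq yA yc.
by move: yl; rewrite (@wc_leaf_unique A s y l) ?eqxx.
Qed.

(** Each cycle vertex carries at most one leaf, so the order is [size c] plus the number of cycle
    vertices in [L]. Either all of them carry a leaf, or exchanges leave only a 4-cycle with leaves
    at two adjacent vertices. *)
Lemma even_card_short_tails A n : C \subset A -> well_covered_in A -> reach A ->
  longest A n -> (n <= 1)%N -> A != C -> ~~ odd #|A|.
Proof.
move=> sCA wcA rA longA n1 nAC.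
have inA y : y \in c -> y \in A by move=> yc; apply: (subsetP sCA); rewrite inE.
have leafP x y : x \in c -> y \in A -> y \notin c -> adj x y ->
    {in A, forall z, adj y z -> z = x}.
  move=> xc yA yc axy; have t1 : tail A x [:: y] by rewrite /tail xc /= axy yA yc.
  apply: (longest_end (q := [::]) longA t1).
  by apply/eqP; rewrite eqn_leq (longA.2 _ _ t1) n1.
pose attached x y := [&& y \in A, y \notin c & adj x y].
have attP y : y \in A -> y \notin c -> exists2 x, x \in c & adj x y.
  move=> yA yc; pose B := C :|: [set z in A | [exists x in c, adj x z]].
  have : y \in B.
    suff -> : B = A by [].
    apply/eqP; apply: contraT => nBA'.
    have sBA : B \subset A by rewrite subUset sCA; apply/subsetP => z; rewrite inE => /andP[].
    have [||b bB [z]] := rA B; first exact: subsetUl.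
      by rewrite properEneq nBA'.
    rewrite inE => /andP[zB zA] abz; case/negP: zB.
    have [bc|bc] := boolP (b \in c).
      by rewrite !inE zA; apply/orP; right; apply/exists_inP; exists b.
    move: bB; rewrite !inE (negPf bc) /= => /andP[bA /exists_inP[x xc axb]].
    by rewrite (leafP x b xc bA bc axb z zA abz) xc.
  by rewrite !inE (negPf yc) yA /= => /exists_inP[x xc axy]; exists x.
have attU x y z : x \in c -> attached x y -> attached x z -> y = z.
  move=> xc /and3P[yA yc xy] /and3P[zA zc xz].
  by apply: (@wc_leaf_unique A x) => //; [apply: inA|apply: leafP xy|apply: leafP xz].
pose L := [set x in c | [exists y, attached x y]].
have cardA : #|A| = (size c + #|L|)%N.
  rewrite -(cardsID C A) (setIidPr sCA) card_C; congr (_ + _)%N.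
  (* A bijection from the leaves onto [L]; the default never occurs on [A :\: C]. *)
  pose f y := odflt y [pick x in c | adj x y].
  have fP y : y \in A :\: C -> [/\ f y \in c, adj (f y) y & attached (f y) y].
    rewrite inE inE => /andP[yc yA]; rewrite /f /attached yA yc.
    case: pickP => [x /andP[xc axy]|none]; first by rewrite /= xc axy.
    by have [x xc axy] := attP y yA yc; have := none x; rewrite xc axy.
  rewrite -(card_in_imset (f := f) (D := A :\: C)).
    apply: eq_card => x; apply/imsetP/idP => [[y /fP[fc _ att] ->]|].
      by rewrite inE fc; apply/existsP; exists y.
    rewrite inE => /andP[xc /existsP[y att]].
    case/and3P: (att) => yA yc axy.
    have yAC : y \in A :\: C by rewrite !inE yc yA.
    exists y => //; have [fc afy _] := fP y yAC.
    by apply/esym/(leafP x y xc yA yc axy); [apply: inA|rewrite adj_sym].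
  move=> y z yA zA eqf; have [fc _ atty] := fP y yA.
  by apply: attU fc atty _; rewrite eqf; have [] := fP z zA.
have [x0 x0L] : exists x, x \in L.
  have [y yA yC] : exists2 y, y \in A & y \notin C.
    by apply/subsetPn; apply: contra nAC => sAC; rewrite eqEsubset sAC.
  rewrite inE in yC; have [x xc axy] := attP y yA yC.
  by exists x; rewrite inE xc; apply/existsP; exists y; rewrite /attached yA yC.
have [allL|/forall_inPn[s sL nsL]] := boolP [forall x in L, next c x \in L].
  suff eqL : L = C by rewrite cardA eqL card_C addnn odd_double.
  move/forall_inP: allL => allL; have : x0 \in c by case/setIdP: x0L.
  case/cycle_param => v [v0 vP vc vn _].
  have vL i : (i < size c)%N -> v i \in L.
    elim: i => [|i IH] lti; first by rewrite v0.
    by rewrite vn //; apply/allL/IH; apply: ltn_trans lti.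
  by apply/setP => y; rewrite [RHS]inE; apply/idP/idP => [|/vP[i /vL ? ->//]]; case/setIdP.
(* From here on [v 0] carries a leaf [l] and its successor [v 1] carries none. *)
have [v [v0 vP vc vn vadj]] := cycle_param (proj1 (elimT setIdP sL)).
have veq i j : (i < size c)%N -> (j < size c)%N -> (v i == v j) = (i == j).
  by move=> lti ltj; case: (vadj i j lti ltj).
have {}vadj i j : (i < size c)%N -> (j < size c)%N -> _ :=
  fun lti ltj => (vadj i j lti ltj).2.
have v1L : v 1%N \notin L by rewrite vn ?v0 //; lia.
have [l /and3P[lA lc]] : exists l, attached s l by apply/existsP; case/setIdP: sL.
rewrite -v0 => al.
have nl := leafP _ l (vc 0%N (ltnW (ltnW c_gt2))) lA lc al.
have nL i y : (i < size c)%N -> v i \notin L -> y \in A -> adj (v i) y -> y \in c.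
  move=> lti; rewrite inE vc //= => /existsPn/(_ y) natt yA aiy.
  by apply: contraNT natt => yc; rewrite /attached yA yc.
have vA i : (i < size c)%N -> v i \in A by move=> /vc/inA.
have [lt0 lt1] : (0 < size c)%N /\ (1 < size c)%N by clear -c_gt2; lia.
have nal i : (i < size c)%N -> (0 < i)%N -> ~~ adj l (v i).
  move=> lti i0; apply/negP => /(nl _ (vA i lti))/eqP; rewrite veq //; clear -i0; lia.
have vl i : (i < size c)%N -> v i != l by move=> lti; apply: contraNneq lc => <-; apply: vc.
(* Trading v0 for l and v1 is possible as soon as some x, not adjacent to v0,
   dominates v2. *)
have trade x : x \in A -> adj x (v 2) -> ~~ adj x (v 0%N) -> False.
  move=> xA ax2 nx0.
  apply: (@wc_exchange _ A [set x] (v 0%N) l (v 1%N)) => //.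
  - by apply: independent2; rewrite adj_sym.
  - by rewrite subUset !sub1set xA vA.
  - by apply: vA.
  - by rewrite vadj.
  - by rewrite eq_sym vl.
  - by apply: nal.
  move=> y yA /orP[/(nl y yA)->|a1y]; first by rewrite eqxx.
  have /vP[j ltj eqy] := nL 1%N y lt1 v1L yA a1y.
  move: a1y; rewrite eqy vadj ?veq // => h h0.
  have -> : j = 2%N by clear -c_gt2 ltj h h0; lia.
  by exists x; rewrite // !inE eqxx orbT.
(* In a triangle [v 2] is already dominated by [v 0], so no auxiliary vertex is required. *)
have [c3|c_gt3] := eqVneq (size c) 3%N.
  case: (@wc_exchange _ A set0 (v 0%N) l (v 1%N)) => //.
  - by rewrite setU0 independent1.
  - by rewrite setU0 sub1set vA.
  - by apply: vA.
  - by rewrite vadj.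
  - by rewrite eq_sym vl.
  - by apply: nal.
  move=> y yA /orP[/(nl y yA)->|a1y]; first by rewrite eqxx.
  have /vP[j ltj eqy] := nL 1%N y lt1 v1L yA a1y.
  move: a1y; rewrite eqy vadj ?veq // => h h0.
  have -> : j = 2%N by clear -c_gt2 ltj h h0; lia.
  by exists (v 0%N); rewrite ?setU11 // vadj // c3.
have lt3 : (3 < size c)%N by clear -c_gt2 c_gt3; lia.
(* The vertex [v 3] can be used in [trade] unless the length is 4, where it is adjacent to [v 0]. *)
have [c4|c_gt4] := eqVneq (size c) 4%N; last first.
  by case: (trade (v 3)); rewrite ?vA ?vadj //; clear -lt3 c_gt4; lia.
have v2L : v 2 \notin L.
  apply/negP => /setIdP[_ /existsP[y /and3P[yA yc a2y]]].
  apply: (trade y yA); first by rewrite adj_sym.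
  apply/negP => /(leafP _ y (vc 2 c_gt2) yA yc a2y _ (vA 0%N lt0))/eqP.
  by rewrite veq.
(* Otherwise [v 2] could be traded for [v 1] and [v 3], with [l] dominating [v 0]. *)
have v3L : v 3 \in L.
  apply: contraT => v3L.
  case: (@wc_exchange _ A [set l] (v 2) (v 1%N) (v 3)) => //.
  - by apply: independent2; rewrite adj_sym nal.
  - by rewrite subUset !sub1set lA vA.
  - by rewrite vA.
  - by rewrite vA.
  - by rewrite vadj.
  - by rewrite vadj.
  - by rewrite veq.
  - by rewrite vadj // c4.
  move=> y yA h.
  have yc : y \in c.
    by case/orP: h => h; [apply: nL v1L yA h|apply: nL v3L yA h].
  have [j ltj eqy] := vP y yc.
  move: h; rewrite eqy !vadj ?veq // c4 => h h0.
  have -> : j = 0%N by clear -ltj h h0 c4; lia.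
  by exists l; rewrite ?inE ?eqxx ?orbT // adj_sym.
suff eqL : L = [set v 0%N; v 3].
  by rewrite cardA eqL cards2 veq // c4.
apply/setP => y; rewrite in_set2; apply/idP/orP.
  move=> /[dup] yL /setIdP[/vP[j]]; rewrite c4 => ltj eqy _.
  case: j => [|[|[|[|//]]]] in ltj eqy *; rewrite eqy in yL *.
  - by left.
  - by rewrite yL in v1L.
  - by rewrite yL in v2L.
  - by right.
by case=> /eqP->; rewrite ?v0.
Qed.

(** Each deletion removes two vertices and so keeps the order odd; parity then rules out short tails
    except on the bare cycle. *)
Lemma odd_wc_built A : C \subset A -> well_covered_in A -> reach A -> odd #|A| ->
  [/\ built A, odd (size c) & (size c < 8)%N].
Proof.
have [m] := ubnP #|A|; elim: m A => // m IH A ltAm sCA wcA rA oddA.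
have [eqA|nAC] := eqVneq A C.
  have oc : odd (size c) by rewrite -card_C -eqA.
  by rewrite eqA; split; [apply: built_cycle| |apply: wc_cycle_lt; rewrite -?eqA].
have [n longA] := exists_longest A.
have [n1|n1] := leqP n 1; first by have := even_card_short_tails sCA wcA rA longA n1 nAC; rewrite oddA.
have [u [s [l [[uA sA lA] sCH asl nl ns]]]] := detach sCA wcA rA longA n1.
have sl : s != l by apply: adj_neq.
have cA := cardsD1 l A; rewrite lA in cA.
have cA' := cardsD1 s (A :\ l); rewrite !inE sl sA /= in cA'.
have [|||||bH oc c8] := IH (A :\ l :\ s) => //.
- by lia.
- exact: wc_delete_leaf.
- apply: (reach_delete (u := u)) => // y yA asy yl; apply/eqP; rewrite -ns //.
  by rewrite !inE yl yA eq_sym adj_neq.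
- by lia.
split => //; have -> : A = l |: (s |: A :\ l :\ s).
  by rewrite setD1K ?setD1K // !inE sl.
apply: (built_add bH uA) => //; rewrite ?inE ?eqxx ?andbF //.
by move=> y; rewrite !inE => /and3P[ys _ yA]; rewrite nl.
Qed.

End Unicyclic.

(** * The polynomial of M n *)

(* The independence polynomial of M n for n = 2k + 3. *)
Definition Mpoly (R : realType) (k : nat) (x : R) : R :=
  (1 + 2 * x) ^+ k.+1 + x * (1 + x) ^+ k.

Section MPoly.
Variable R : realType.
Implicit Types x : R.

Lemma Mpoly_rec k x :
  Mpoly k.+1 x = (1 + x) * Mpoly k x + x * (1 + 2 * x) ^+ k.+1.
Proof. by rewrite /Mpoly !exprS; ring. Qed.

(** In [Mpoly_rec] the last term is negative for [x < 0], so [(1 + x) * Mpoly k x] exceeds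
    [Mpoly k.+1 x]. *)
Lemma Mpoly_gt0 k x : - 2^-1 < x -> x <= 0 -> 0 <= Mpoly k.+1 x -> 0 < Mpoly k x.
Proof.
move=> x2; rewrite le_eqVlt => /predU1P[-> _|x0].
  by rewrite /Mpoly !(mulr0, mul0r, addr0) expr1n.
rewrite Mpoly_rec => h; have e : 0 < (1 + 2 * x) ^+ k.+1 by apply: exprn_gt0; lra.
by nra.
Qed.

(** Descend to [k = 0], where the polynomial is [1 + 3 * x]. *)
Lemma Mpoly_ge_third k x : - 2^-1 < x -> x <= 0 -> 0 <= Mpoly k x -> - 3^-1 <= x.
Proof.
move=> x2 x0; elim: k => [|k IH]; first by rewrite /Mpoly expr1 expr0; lra.
by move=> /Mpoly_gt0 h; apply/IH/ltW/h.
Qed.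

Lemma Mpoly_neg_half k : Mpoly k (- 2^-1 : R) < 0.
Proof.
rewrite /Mpoly (_ : 1 + 2 * - 2^-1 = 0) ?exprS ?mul0r ?add0r; last by lra.
have : 0 < (1 + - 2^-1 : R) ^+ k by apply: exprn_gt0; lra.
by nra.
Qed.

(** The interval cannot contain [- 2^-1], where [Mpoly k] is negative, so the descent applies at
    [x0]. *)
Lemma Mpoly_range k x0 : x0 <= 0 ->
  (forall x, x0 <= x <= 0 -> 0 <= Mpoly k x) -> - 3^-1 <= x0.
Proof.
move=> x00 h; apply: (@Mpoly_ge_third k) => //; last by apply: h; rewrite lexx.
rewrite ltNge; apply/negP => x02; have := Mpoly_neg_half k.
by rewrite ltNge h // x02; lra.
Qed.

End MPoly.

(** * Polynomial and smallest root of the graph [M n] *)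

Section MGraph.
Variables (R : realType) (n : nat).
Let c0 : M n := inl ord0.

(** The perfect matching left after deleting the centre: the opposite triangle edge and the copies
    of K_2. The value at the centre is a dummy. *)
Definition M_mate (v : M n) : M n :=
  match v with
  | inl i => inl (if val i == 1%N then inord 2 else inord 1)
  | inr (j, b) => inr (j, ~~ b)
  end.

(** Branch on the centre: deleting it leaves [k.+1] disjoint edges; deleting its closed
    neighbourhood leaves the [k] far ends, which are independent. *)
Lemma indep_poly_M (x : R) : odd n -> (3 <= n)%N ->
  (indep_poly (M n) R).[x] = Mpoly (n - 3)./2 x.
Proof.
move=> odd_n n_ge3; set k := (n - 3)./2.
have nE : n = (k.*2 + 3)%N by rewrite /k; lia.
rewrite indep_poly_ip (@horner_ip_rec _ _ c0) ?in_setT // /Mpoly.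
have inlE (i j : 'I_3) : (inl i == inl j :> M n) = (i == j) by [].
have inrE (p q : 'I_k * bool) : (inr p == inr q :> M n) = (p == q) by [].
congr (_ + x * _).
- apply: (@horner_ip_perfect_matching _ _ M_mate).
  + have := cardsD1 c0 [set: M n]; rewrite in_setT cardsT card_M //.
    by move=> h; lia.
  + case=> [i|[j b]] _; rewrite !inE //= inlE.
    by case: ifP => _; rewrite -val_eqE /= inordK.
  + case=> [i|[j b]]; case=> [i'|[j' b']]; rewrite !inE ?inlE ?inrE ?andbT /=.
    * by case: i i' => [[|[|[|//]]] ?] [[|[|[|//]]] ?]; rewrite //= => _ _; rewrite -val_eqE /= inordK.
    * by move=> /negPf->.
    * by move=> _ /negPf->.
    * by move=> _ _; rewrite xpair_eqE eq_sym; case: b; case: b'.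
- set A := _ :\: _.
  have eqA : A = [set inr (j, false) | j : 'I_k].
    apply/setP; case=> [i|[j b]]; rewrite !inE /=.
      rewrite -[inl _ == inl _]/(i == ord0) eq_sym; case: eqP => [->|_] /=.
        by apply/esym/imsetP => -[].
      by apply/esym/imsetP => -[].
    rewrite andbT; case: b => /=; first by apply/esym/imsetP => -[? _ []].
    by apply/esym/imsetP; exists j.
  rewrite horner_ip_independent; last first.
    rewrite eqA; apply/independentP => _ _ /imsetP[j _ ->] /imsetP[j' _ ->].
    by rewrite /= andbF.
  by rewrite eqA card_imset ?card_ord // => j j' [].
Qed.

(** A negative value at [y] would give a root in [(y, 0]], of modulus smaller than that of [xi]. *)
Lemma M_preceq_range (x : R) : odd n -> (3 <= n)%N -> xi (M n) R <= x ->
  forall y, x <= y <= 0 -> 0 <= Mpoly (n - 3)./2 y.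
Proof.
move=> odd_n n_ge3 xix y /andP[xy y0]; rewrite -indep_poly_M // leNgt.
set q := indep_poly _ _; apply/negP => qy.
have q0 : q.[0] = 1 by rewrite /q indep_poly_ip ip_at0.
have [|r /andP[yr r0] rq] := @poly_ivt _ q y 0 y0; first by rewrite ltW // q0 ler01.
have {}yr : y < r.
  rewrite lt_neqAle yr andbT; apply: contraTneq qy => ->.
  by move/rootP: rq => ->; rewrite ltxx.
move: xix; rewrite /xi; case: classical_sets.xgetP => [z _ [_ small]|_ x0].
  move=> xix; have := small r%:C%C.
  have -> : indep_poly (M n) R[i] = map_poly (real_complex R) q.
    apply/polyP => i; rewrite coef_map !coef_poly.
    by case: ifP => _; rewrite ?rmorph0 //; apply/esym/(rmorph_nat (real_complex R)).
  rewrite (fmorph_root (real_complex R)) => /(_ rq).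
  rewrite !normc_def /= !expr0n /= !addr0 !sqrtr_sqr lecR !ler0_norm //; last first.
    by lra.
  by lra.
(* Without a smallest root [xi] is the default 0, so [y = 0], where the polynomial is 1. *)
by move: qy; rewrite (_ : y = 0) ?q0; lra.
Qed.

End MGraph.

(** * Induction along the structure *)

(** The independence polynomial of the path on [n] vertices; the inner [1] makes the recurrence
    valid for a single vertex. *)
Fixpoint path_poly (R : realType) (n : nat) (x : R) : R :=
  match n with
  | 0 => 1
  | n'.+1 => path_poly n' x + x * (if n' is n''.+1 then path_poly n'' x else 1)
  end.

Section InducedPath.
Variables (R : realType) (G : sgraph).

Fixpoint induced_path (p : seq G) : bool :=
  if p is v :: p' then
    [&& v \notin p', all (fun y => adj v y == (y == head v p')) p' & induced_path p']
  else true.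

Lemma horner_ip_path (p : seq G) (x : R) : induced_path p ->
  (ip R [set y in p]).[x] = path_poly (size p) x.
Proof.
have [n] := ubnP (size p); elim: n p => // n IH [|v p] ltpn.
  by move=> _; rewrite set_nil ip0 hornerE.
case/and3P=> vp /allP nv ip; rewrite (@horner_ip_rec _ _ v) ?inE ?eqxx //.
have -> : [set y in v :: p] :\ v = [set y in p].
  apply/setP => y; rewrite !inE; case: (eqVneq y v) => [->|//].
  by rewrite (negPf vp).
rewrite IH // [RHS]/=; congr (_ + x * _).
case: p => [|w p] in vp nv ip ltpn *.
  by rewrite set_nil set0D ip0 hornerE.
case/and3P: (ip) => wp _ ip'.
have -> : [set y in w :: p] :\: nbhd v = [set y in p].
  apply/setP => y; rewrite !inE.
  have [->|yw] /= := eqVneq y w.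
    by rewrite (eqP (nv w (mem_head _ _))) eqxx (negPf wp).
  have [yp|] := boolP (y \in p); last by rewrite andbF.
  by rewrite (eqP (nv y _)) ?inE ?yp ?orbT //= yw.
by rewrite IH //; move: ltpn => /=; lia.
Qed.

End InducedPath.

(** * Bounds for cycles and for the sets built from them *)

Section UnicyclicPolynomial.
Variables (R : realType) (G : sgraph) (c : seq G).
Hypothesis c_gt2 : (2 < size c)%N.
Hypothesis ucycle_c : ucycle (@adj G) c.
Hypothesis only_cycle : forall c' : seq G,
  (2 < size c')%N -> ucycle (@adj G) c' -> c' =i c.
Implicit Types (x : R) (A H : {set G}).
Local Notation C := [set x in c].

(** Deleting [u] leaves a path, and deleting its two neighbours as well leaves a path with
    [size c - 3] vertices. *)
Lemma horner_ip_cycle u x : u \in c ->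
  (ip R (C :\ u)).[x] = path_poly (size c).-1 x /\
  (ip R C).[x] = path_poly (size c).-1 x + x * path_poly (size c - 3) x.
Proof.
move=> uc; have [v [v0 vP vc _ vadj]] := cycle_param c_gt2 ucycle_c only_cycle uc.
have veq i j : (i < size c)%N -> (j < size c)%N -> (v i == v j) = (i == j).
  by move=> lti ltj; case: (vadj i j lti ltj).
have {}vadj i j : (i < size c)%N -> (j < size c)%N -> _ :=
  fun lti ltj => (vadj i j lti ltj).2.
have ind a n : (0 < a)%N -> (a + n <= size c)%N -> induced_path (map v (iota a n)).
  elim: n a => // n IH a a0 an /=; rewrite IH //; last by lia.
  rewrite andbT; apply/andP; split.
    apply/negP => /mapP[j]; rewrite mem_iota => hj /eqP; rewrite veq; lia.
  apply/allP => y /mapP[j]; rewrite mem_iota => hj eqy; rewrite {y}eqy; clear IH.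
  case: n an hj => [|n] an hj; first by lia.
  by rewrite /= vadj ?veq; lia.
have setE a n : (0 < a)%N -> (a + n <= size c)%N ->
    [set y in map v (iota a n)] = [set y in c | [exists i : 'I_(size c),
       (a <= i < a + n)%N && (y == v i)]].
  move=> a0 an; apply/setP => y; rewrite !inE; apply/mapP/andP.
    case=> i; rewrite mem_iota => hi ->; have lti : (i < size c)%N by lia.
    by rewrite vc //; split => //; apply/existsP; exists (Ordinal lti); rewrite hi /=.
  by case=> _ /existsP[i /andP[hi /eqP->]]; exists (val i); rewrite // mem_iota.
have eq1 : C :\ u = [set y in map v (iota 1 (size c).-1)].
  rewrite setE //; last by lia.
  apply/setP => y; rewrite !inE andbC; have [yc|//] := boolP (y \in c).
  have [i lti ->] := vP y yc; rewrite -v0 veq //=; last by lia.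
  apply/idP/existsP => [i0|[j /andP[hj]]].
    by exists (Ordinal lti); rewrite /= eqxx andbT; lia.
  by rewrite veq //; lia.
have eq2 : (C :\ u) :\: nbhd u = [set y in map v (iota 2 (size c - 3))].
  rewrite setE //; last by lia.
  apply/setP => y; rewrite !inE; have [yc|] := boolP (y \in c); last by rewrite !andbF.
  have [i lti ->] := vP y yc; rewrite -v0 vadj ?veq //=; try lia.
  apply/idP/existsP => [i0|[j /andP[hj]]].
    by exists (Ordinal lti); rewrite /= eqxx andbT; lia.
  by rewrite veq //; lia.
have e1 : (ip R (C :\ u)).[x] = path_poly (size c).-1 x.
  by rewrite eq1 horner_ip_path ?size_map ?size_iota // ind //; lia.
split => //; rewrite (@horner_ip_rec _ _ u) ?inE // e1 eq2.
by rewrite horner_ip_path ?size_map ?size_iota // ind //; lia.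
Qed.

Hypothesis c_odd : odd (size c).
Hypothesis c_lt8 : (size c < 8)%N.

Lemma cycle_bounds k x : - 3^-1 <= x <= 0 -> size c = (k.*2 + 3)%N ->
  [/\ Mpoly k x <= (ip R C).[x],
      (1 + x) * (ip R C).[x] <= (1 + 2 * x) ^+ k.+2 &
      forall u, u \in c -> (ip R (C :\ u)).[x] <= (1 + 2 * x) ^+ k.+1].
Proof.
move=> /andP[x3 x0] sk.
have [s sc] : exists s, s \in c by case: (c) c_gt2 => // s c' _; exists s; rewrite mem_head.
have [_ ->] := horner_ip_cycle x sc.
have x2 : 0 <= x ^+ 2 by apply: sqr_ge0.
(* For [k = 1, 2] the second bound has difference [C5], [C7]; for [k = 2] the third has [P7] and the
   first has twice [M7]. All other differences are 0 or [x ^+ 2]. *)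
have C7 : 0 <= x ^+ 2 * (3 + 11 * x + 9 * x ^+ 2) by apply: mulr_ge0 => //; nra.
have C5 : 0 <= x ^+ 2 * (2 + 3 * x) by apply: mulr_ge0 => //; lra.
have P7 : 0 <= x ^+ 2 * (2 + 4 * x) by apply: mulr_ge0 => //; lra.
have M7 : 0 <= x ^+ 2 * (- x) by apply: mulr_ge0 => //; lra.
have [k0|[k1|k2]] : k = 0%N \/ k = 1%N \/ k = 2 by lia.
- rewrite sk k0; split; rewrite /Mpoly /= ?exprS ?expr0; [lra|nra|].
  by move=> u uc; rewrite (horner_ip_cycle x uc).1 sk k0 /=; lra.
- rewrite sk k1; split; rewrite /Mpoly /= ?exprS ?expr0; [lra|nra|].
  by move=> u uc; rewrite (horner_ip_cycle x uc).1 sk k1 /=; lra.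
- rewrite sk k2; split; rewrite /Mpoly /= ?exprS ?expr0; [lra|nra|].
  by move=> u uc; rewrite (horner_ip_cycle x uc).1 sk k2 /=; lra.
Qed.

Lemma card_built A : built c A -> exists k, #|A| = (k.*2 + 3)%N.
Proof.
elim=> [|H u s l _ [k cH] uH sH lH asl _ _].
  by exists (size c - 3)./2; rewrite (card_C ucycle_c); lia.
by exists k.+1; rewrite cardsU1 cardsU1 sH !inE negb_or lH eq_sym (adj_neq asl) /= cH; lia.
Qed.

Lemma card_built_add H s l k : built c H -> s \notin H -> l \notin H -> adj s l ->
  #|l |: (s |: H)| = (k.*2 + 3)%N -> exists2 k', k = k'.+1 & #|H| = (k'.*2 + 3)%N.
Proof.
move=> bH sH lH asl; have [k' cH] := card_built bH.
rewrite cardsU1 cardsU1 sH !inE negb_or lH eq_sym (adj_neq asl) /= cH => h.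
by exists k' => //; lia.
Qed.

Lemma setU2_D2 H s l : s != l -> s \notin H -> l \notin H ->
  (l |: (s |: H)) :\ l :\ s = H.
Proof. by move=> sl sH lH; rewrite setU1K ?setU1K // !inE negb_or eq_sym sl lH. Qed.

(** The two bounds go together: deleting [s] or [l] leaves [H] with one more vertex, of factor at
    most [1 + x], and the first bound for [H] applies; for [w] in [H], peel off the edge [s]-[l] and
    use the second. *)
Lemma built_upper A k x : - 3^-1 <= x <= 0 -> built c A -> ip_pos A x ->
  #|A| = (k.*2 + 3)%N ->
  (1 + x) * (ip R A).[x] <= (1 + 2 * x) ^+ k.+2 /\
  forall u, u \in A -> (ip R (A :\ u)).[x] <= (1 + 2 * x) ^+ k.+1.
Proof.
move=> hx bA; have [x3 x0] := andP hx; elim: bA k => [|H u s l bH IH uH sH lH asl ns nl] k pA cA.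
  rewrite (card_C ucycle_c) in cA; have [_ h1 h2] := cycle_bounds hx cA.
  by split => // u; rewrite inE; apply: h2.
have [k' ek cH] := card_built_add bH sH lH asl cA; subst k.
have sl := adj_neq asl.
have sHA : H \subset l |: (s |: H) by rewrite setUA subsetUr.
have pH : ip_pos H x by apply: ip_posS pA.
have [IH1 IH2] := IH k' pH cH.
have lA : l \in l |: (s |: H) by rewrite setU11.
have sA : s \in l |: (s |: H) by rewrite !inE eqxx orbT.
have DH := setU2_D2 sl sH lH.
have edge (B : {set G}) : s \in B -> l \in B -> B \subset l |: (s |: H) ->
    (ip R B).[x] <= (1 + 2 * x) * (ip R (B :\ l :\ s)).[x].
  move=> sB lB sBA; apply: ip_le_edge => //; last by rewrite adj_sym.
  exact: ip_posS sBA pA.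
split.
  have := edge _ sA lA (subxx _); rewrite DH [_ ^+ k'.+3]exprS => h.
  have := IH1; nra.
move=> w; rewrite !inE => /or3P[/eqP->|/eqP->|wH].
- have -> : (l |: (s |: H)) :\ l = s |: H by rewrite setU1K // !inE negb_or eq_sym sl.
  apply: le_trans IH1; rewrite -{2}(setU1K sH); apply: ip_le_D1; rewrite ?setU11 //.
  by apply: ip_posS pA; apply: subsetUr.
- have -> : (l |: (s |: H)) :\ s = l |: H.
    by rewrite setUCA setU1K // !inE negb_or sl sH.
  apply: le_trans IH1; rewrite -{2}(setU1K lH); apply: ip_le_D1; rewrite ?setU11 //.
  by apply: ip_posS pA; apply: setUS; apply: subsetUr.
- have sw : s != w by apply: contraNneq sH => ->.
  have lw : l != w by apply: contraNneq lH => ->.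
  have -> : (1 + 2 * x) ^+ k'.+2 = (1 + 2 * x) * (1 + 2 * x) ^+ k'.+1 by rewrite exprS.
  have := edge ((l |: (s |: H)) :\ w) _ _ (subsetDl _ _).
  rewrite !inE sw lw !eqxx !orbT => /(_ isT isT) h; apply: le_trans h _.
  rewrite ler_wpM2l //; first by lra.
  have -> : (l |: (s |: H)) :\ w :\ l :\ s = H :\ w.
    by rewrite -{2}DH !setDDl; congr (_ :\: _); rewrite setUC setUA.
  exact: IH2.
Qed.

(** Since [x <= 0], the upper bound on [H :\ u] becomes a lower bound in the leaf recurrence, which
    then matches [Mpoly_rec] term by term. *)
Lemma built_lower A k x0 : x0 <= 0 -> built c A -> #|A| = (k.*2 + 3)%N ->
  (forall x, x0 <= x <= 0 -> 0 <= Mpoly k x) ->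
  forall x, x0 <= x <= 0 -> Mpoly k x <= (ip R A).[x].
Proof.
move=> x00 bA; elim: bA k => [|H u s l bH IH uH sH lH asl ns nl] k cA Mk x /[dup] hx /andP[x0x xle0].
  rewrite (card_C ucycle_c) in cA; have := Mpoly_range x00 Mk => x03.
  by have [] := @cycle_bounds k x _ cA => //; rewrite xle0 (le_trans x03).
have [k' ek cH] := card_built_add bH sH lH asl cA; subst k.
have x03 := Mpoly_range x00 Mk.
have Mk' y : x0 <= y <= 0 -> 0 < Mpoly k' y.
  move=> /[dup] /Mk My /andP[x0y y0]; apply: Mpoly_gt0 => //.
  by apply: lt_le_trans x0y; lra.
have IHH y : x0 <= y <= 0 -> Mpoly k' y <= (ip R H).[y].
  by apply: IH => // z /Mk'/ltW.
(* The induction hypothesis keeps [H] positive on all of [[x0, 0]], and positivity passes to its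
   induced subgraphs. *)
have pH : ip_pos H x.
  move=> B sBH; apply: (ip_gt0_sub sBH) hx => y hy.
  exact: lt_le_trans (Mk' y hy) (IHH y hy).
have sl := adj_neq asl.
have DH := setU2_D2 sl sH lH.
have -> : (ip R (l |: (s |: H))).[x] = (1 + x) * (ip R H).[x] + x * (ip R (H :\ u)).[x].
  rewrite (@horner_ip_leaf _ _ s l) ?setU11 //; last 2 first.
  - by rewrite !inE eqxx orbT.
  - move=> y; rewrite !inE => /or3P[/eqP->|/eqP->|yH].
    + by rewrite adj_irrefl eq_sym (negPf sl).
    + by rewrite adj_sym asl eqxx.
    + by rewrite (negPf (nl y yH)); apply/esym/negbTE; apply: contraNneq sH => <-.
  rewrite DH; congr (_ + x * (ip R _).[x]).
  apply/setP => y; rewrite !inE; have [yH|] := boolP (y \in H); last by rewrite !andbF.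
  by rewrite ns.
rewrite Mpoly_rec.
have [|_ /(_ u uH) upper] := @built_upper H k' x _ bH pH cH.
  by rewrite xle0 (le_trans x03).
have := IHH x hx; nra.
Qed.

End UnicyclicPolynomial.

(** * From the hypotheses on the graph to the cycle data, and the conclusion *)

Section Cycles.
Variable G : sgraph.

(** The vertices of a cycle are the union of its edges, so uniqueness of the edge set gives
    uniqueness of the vertex set. *)
Lemma mem_cycle_edges (c1 c2 : seq G) :
  cycle_edges c1 = cycle_edges c2 -> {subset c1 <= c2}.
Proof.
move=> eqc x xc; have : [set x; next c1 x] \in cycle_edges c2.
  by rewrite -eqc; apply/imsetP; exists x.
case/imsetP => y yc /setP/(_ x); rewrite !inE eqxx /=.
by move/esym/orP => [/eqP->|/eqP->]; rewrite ?mem_next.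
Qed.

Lemma unicyclic_cycle : unicyclic G -> exists c : seq G,
  [/\ (2 < size c)%N, ucycle (@adj G) c &
    forall c' : seq G, (2 < size c')%N -> ucycle (@adj G) c' -> c' =i c].
Proof.
case=> _ [[c [c2 uc ->]] onlyc]; exists c; split => // c' c'2 uc' x.
have eqc : cycle_edges c = cycle_edges c' by apply: onlyc; exists c'.
by apply/idP/idP; apply: mem_cycle_edges.
Qed.

(** A set that no edge leaves is closed under [adj], hence contains everything connected to the
    cycle. *)
Lemma connected_reach (c : seq G) : c != [::] -> connected G -> reach c [set: G].
Proof.
case: c => // s c _ conn B sCB /properP[_ [w _ wB]].
have sB : s \in B by apply: (subsetP sCB); rewrite inE mem_head.
have [/exists_inP[b bB /exists_inP[y yB aby]]|none] :=
    boolP [exists b in B, exists y in [set: G] :\: B, adj b y].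
  by exists b => //; exists y.
have stay b y : adj b y -> b \in B -> y \in B.
  move=> aby bB; apply: contraNT none => yB.
  by apply/exists_inP; exists b => //; apply/exists_inP; exists y; rewrite // !inE yB.
have clB : closed (@adj G) (mem B).
  move=> b y aby; apply/idP/idP; apply: stay => //; by rewrite adj_sym.
by have := closed_connect clB (conn s w); rewrite sB (negPf wB).
Qed.

End Cycles.

Theorem theorem3p15 (R : realType) (n : nat) (G : sgraph) :
  odd n -> #|G| = n ->
  connected G -> well_covered G -> unicyclic G ->
  preceq R G (M n).
Proof.
move=> odd_n cardG conn wcG /unicyclic_cycle[c [c_gt2 uc onlyc]] x /andP[xix x0].
have c0 : c != [::] by case: (c) c_gt2.
have n_ge3 : (3 <= n)%N.
  by rewrite -cardG (leq_trans c_gt2) // -(card_uniqP (uniq_c uc)) max_card.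
have [|bG c_odd c_lt8] := odd_wc_built c_gt2 uc onlyc (subsetT _) (wc_setT wcG)
  (connected_reach c0 conn).
  by rewrite cardsT cardG.
rewrite indep_poly_M // indep_poly_ip.
(* The left end of the interval is [x] itself. *)
apply: (built_lower c_gt2 uc onlyc c_odd c_lt8 x0 bG); last by rewrite lexx.
  by rewrite cardsT cardG; lia.
exact: M_preceq_range.
Qed.
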